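(* Let $n\ge 3$ be an odd integer and let $G_n$ be the Goldberg snark on $n$ building blocks. Then $\tau(G_n)=\lceil 9n/2\rceil$.
   Context: All graphs are simple, finite and undirected. $\tau(G)$ denotes the vertex cover number of $G$, i.e., the minimum cardinality of a set $C\subseteq V(G)$ such that every edge of $G$ has at least one endpoint in $C$. For $i\in\{1,\ldots,n\}$, the building block $B_i$ is the graph with vertex set $V(B_i)=\{a_i,b_i,c_i,d_i,e_i,f_i,g_i,h_i\}$ and edge set $E(B_i)=\{a_ib_i,\,a_ie_i,\,b_ic_i,\,c_id_i,\,c_if_i,\,d_ie_i,\,d_ih_i,\,e_ig_i,\,f_ig_i\}$; distinct blocks are vertex-disjoint. For indices $j,\ell$, let $E_{j,\ell}=\{b_ja_\ell,\,g_jf_\ell,\,h_jh_\ell\}$. For odd $n\ge 3$, the Goldberg snark $G_n$ is the graph with $V(G_n)=\bigcup_{i=1}^n V(B_i)$ and $E(G_n)=\left(\bigcup_{i=1}^n E(B_i)\right)\cup\left(\bigcup_{j=1}^{n-1}E_{j,j+1}\right)\cup E_{n,1}$. *)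

(* Defs.v *)
From HB Require Import structures.
From mathcomp Require Import all_boot.

Set Implicit Arguments.
Unset Strict Implicit.
Unset Printing Implicit Defensive.

(* A simple graph is a symmetric irreflexive relation on a finType. *)

Definition vertex_cover (T : finType) (adj : rel T) (C : {set T}) : bool :=
  [forall x, forall y, adj x y ==> (x \in C) || (y \in C)].

Lemma vertex_cover_setT (T : finType) (adj : rel T) : vertex_cover adj setT.
Proof. by apply/forallP=> x; apply/forallP=> y; rewrite in_setT implybT. Qed.

(* The minimum is well defined because [setT] is a cover, by the lemma above. *)
Definition vertex_cover_number (T : finType) (adj : rel T) : nat :=
  #|[arg min_(C < [set: T] | vertex_cover adj C) #|C| ]|.

Variant label : Set := La | Lb | Lc | Ld | Le | Lf | Lg | Lh.

Definition label_to_ord (u : label) : 'I_8 :=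
  inord match u with
        | La => 0 | Lb => 1 | Lc => 2 | Ld => 3
        | Le => 4 | Lf => 5 | Lg => 6 | Lh => 7
        end.

Definition label_of_ord (i : 'I_8) : label :=
  nth La [:: La; Lb; Lc; Ld; Le; Lf; Lg; Lh] i.

Lemma label_to_ordK : cancel label_to_ord label_of_ord.
Proof. by case; rewrite /label_of_ord /label_to_ord inordK. Qed.

HB.instance Definition _ := Countable.copy label (can_type label_to_ordK).
HB.instance Definition _ : isFinite label := CanIsFinite label_to_ordK.

(* Each undirected edge is listed in one direction only; [goldberg_adj] takes
   the symmetric closure. *)
Definition block_arc (u v : label) : bool :=
  match u, v with
  | La, Lb | La, Le | Lb, Lc | Lc, Ld | Lc, Lf
  | Ld, Le | Ld, Lh | Le, Lg | Lf, Lg => true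
  | _, _ => false
  end.

Definition link_arc (u v : label) : bool :=
  match u, v with
  | Lb, La | Lg, Lf | Lh, Lh => true
  | _, _ => false
  end.

(* The vertex (i, u) is the vertex labelled u of the block B_(i+1).  Since
   [ordS] is the cyclic successor on 'I_n, the links are those of the sets
   E_(j,j+1) for 1 <= j < n together with those of E_(n,1). *)
Definition goldberg_arc (n : nat) : rel ('I_n * label) :=
  fun x y =>
    ((y.1 == x.1) && block_arc x.2 y.2) ||
    ((y.1 == ordS x.1) && link_arc x.2 y.2).

Definition goldberg_adj (n : nat) : rel ('I_n * label) :=
  fun x y => goldberg_arc x y || goldberg_arc y x.

Lemma goldberg_adj_sym (n : nat) : symmetric (@goldberg_adj n).
Proof. by move=> x y; rewrite /goldberg_adj orbC. Qed.

Lemma goldberg_adj_irr (n : nat) : 1 < n -> irreflexive (@goldberg_adj n).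
Proof.
move=> n_gt1 [i u]; rewrite /goldberg_adj /goldberg_arc orbb /= eqxx /=.
suff /negbTE-> : i != ordS i by case: u.
apply/eqP=> /(congr1 val) /= iE; have := ltn_ord i.
rewrite leq_eqVlt => /predU1P[iS | lt_iS]; last first.
  by move: iE; rewrite modn_small // => /eqP; rewrite eqn_leq ltnn andbF.
by move: iE; rewrite iS modnn => i0; move: n_gt1; rewrite -[X in _ < X]iS i0.
Qed.

(* Main.v *)
Require Import Defs.
From mathcomp Require Import all_boot.

(** The weight of a block is the number of its vertices that lie in a cover C.
    Lower bound: a block contains the 5-cycle a b c d e and the disjoint edge
    f g, which cost at least 3 and 1, while h lies on neither.  So the weight is
    at least 4, and at least 5 if h is in C ([block_weight_ge]).  Consecutive
    blocks are joined by an edge h h, hence one of their two h vertices is in C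
    and their weights add up to at least 9 ([consecutive_blocks_ge]).  Summing
    around the ring counts every block twice, so 2 |C| >= 9 n, for either parity
    of n.

    Upper bound: a, c, d, g of every block cover every edge except the links
    h h.  These links form a cycle of length n, and for odd n the vertices h of
    the (n + 1) / 2 blocks with even index cover it, including the closing link,
    which joins two even indices.  This gives a cover of size
    4 n + (n + 1) / 2 = uphalf (9 n). *)

Set Implicit Arguments.
Unset Strict Implicit.
Unset Printing Implicit Defensive.

Lemma vertex_cover_numberP (T : finType) (adj : rel T) (k : nat) :
    (exists2 C : {set T}, vertex_cover adj C & #|C| = k) ->
    (forall C : {set T}, vertex_cover adj C -> k <= #|C|) ->
  vertex_cover_number adj = k.
Proof.
move=> [C0 coverC0 cardC0] k_min; rewrite /vertex_cover_number.
case: arg_minnP => [|C coverC C_min]; first exact: vertex_cover_setT.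
by apply/eqP; rewrite eqn_leq k_min // -cardC0 C_min.
Qed.

Lemma big_label (F : label -> nat) :
  \sum_u F u = F La + F Lb + F Lc + F Ld + F Le + F Lf + F Lg + F Lh.
Proof.
have label_of_ordK : cancel label_of_ord label_to_ord.
  move=> i; apply: val_inj; case: i.
  by do 8![case=> [|] //=; first by move=> ?; rewrite /label_to_ord inordK].
rewrite (reindex label_of_ord) /=; last first.
  by apply: onW_bij; exists label_to_ord; [|exact: label_to_ordK].
by rewrite !big_ord_recl big_ord0 /= addn0 !addnA.
Qed.

Definition block_weight n (C : {set 'I_n * label}) (i : 'I_n) : nat :=
  \sum_(u : label) ((i, u) \in C).

Lemma card_block_weight n (C : {set 'I_n * label}) :
  #|C| = \sum_i block_weight C i.
Proof.
rewrite /block_weight pair_bigA /= -sum1_card big_mkcond /=.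
by apply: eq_bigr => -[i u] _ /=; case: ifP.
Qed.

Section LowerBound.

Variables (n : nat) (C : {set 'I_n * label}).
Hypothesis coverC : vertex_cover (@goldberg_adj n) C.

Lemma cover_block_arc i u v :
  block_arc u v -> ((i, u) \in C) || ((i, v) \in C).
Proof.
move=> uv; move/forallP/(_ (i, u))/forallP/(_ (i, v))/implyP: coverC; apply.
by rewrite /goldberg_adj /goldberg_arc /= eqxx uv.
Qed.

Lemma cover_link_arc i u v :
  link_arc u v -> ((i, u) \in C) || ((ordS i, v) \in C).
Proof.
move=> uv; move/forallP/(_ (i, u))/forallP/(_ (ordS i, v))/implyP: coverC.
by apply; rewrite /goldberg_adj /goldberg_arc /= eqxx uv orbT.
Qed.

(** The 5-cycle a b c d e needs three vertices and the edge f g a fourth; the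
    vertex h belongs to neither, so it is counted in addition to these four. *)
Lemma block_weight_ge i : 4 + ((i, Lh) \in C) <= block_weight C i.
Proof.
rewrite /block_weight big_label leq_add2r.
have:= (@cover_block_arc i La Lb isT, @cover_block_arc i La Le isT,
        @cover_block_arc i Lb Lc isT, @cover_block_arc i Lc Ld isT,
        @cover_block_arc i Ld Le isT, @cover_block_arc i Lf Lg isT).
by do 7!case: (_ \in C) => //=; do ?case=> //.
Qed.

Lemma consecutive_blocks_ge i :
  9 <= block_weight C i + block_weight C (ordS i).
Proof.
apply: leq_trans (leq_add (block_weight_ge i) (block_weight_ge (ordS i))).
by have /orP[-> | ->] := @cover_link_arc i Lh Lh isT; case: (_ \in C).
Qed.

Lemma goldberg_cover_ge : uphalf (9 * n) <= #|C|.
Proof.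
rewrite leq_uphalf_double -addnn card_block_weight.
rewrite [X in _ <= _ + X](reindex_inj (@ordS_inj n)) -big_split /=.
rewrite mulnC -[X in X * 9]card_ord -sum_nat_const.
by apply: leq_sum => i _; exact: consecutive_blocks_ge.
Qed.

End LowerBound.

Definition alternating_cover n : {set 'I_n * label} :=
  [set x : 'I_n * label | match x.2 with
           | La | Lc | Ld | Lg => true
           | Lh => ~~ odd x.1
           | _ => false
           end].

(** For odd n the last index n - 1 is even, and so is its cyclic successor 0:
    two odd indices are never consecutive on the ring. *)
Lemma odd_ordS n (i : 'I_n) : odd n -> odd i -> ~~ odd (ordS i).
Proof.
move=> n_odd i_odd /=; have := ltn_ord i; rewrite leq_eqVlt => /predU1P[iS | lt].
  by rewrite iS modnn.
by rewrite modn_small //= i_odd.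
Qed.

Lemma alternating_cover_arc n (x y : 'I_n * label) : odd n ->
  goldberg_arc x y ->
  (x \in alternating_cover n) || (y \in alternating_cover n).
Proof.
case: x y => [i u] [j v] n_odd; rewrite /goldberg_arc !inE /=.
case/orP=> /andP[/eqP-> ]; first by case: u; case: v.
case: u; case: v => //= _; rewrite -negb_and.
by apply/negP=> /andP[/(odd_ordS n_odd)/negP].
Qed.

Lemma alternating_cover_vertex_cover n : odd n ->
  vertex_cover (@goldberg_adj n) (alternating_cover n).
Proof.
move=> n_odd; apply/forallP=> x; apply/forallP=> y; apply/implyP.
by case/orP=> /(alternating_cover_arc n_odd) //; rewrite orbC.
Qed.

Lemma sum_even_ord n : \sum_(i < n) ~~ odd i = uphalf n.
Proof.
elim: n => [|n IHn]; first by rewrite big_ord0.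
by rewrite big_ord_recr /= IHn uphalf_half; case: (odd n); rewrite /= ?addn0 ?addn1.
Qed.

Lemma card_alternating_cover n : #|alternating_cover n| = uphalf (9 * n).
Proof.
have weightE i : block_weight (alternating_cover n) i = 4 + ~~ odd i.
  by rewrite /block_weight big_label !inE.
rewrite card_block_weight (eq_bigr _ (fun i _ => weightE i)) big_split /=.
rewrite sum_nat_const card_ord sum_even_ord.
(* 9 n = 2 (4 n) + n *)
by rewrite -[9]/(8 + 1) mulnDl mul1n -[8]/(2 * 4) -mulnA mul2n !uphalf_half
  halfD !oddD odd_double doubleK /= mulnC add0n addnCA.
Qed.

Theorem theorem16 (n : nat) (n_ge3 : 3 <= n) (n_odd : odd n) :
  vertex_cover_number (@goldberg_adj n) = uphalf (9 * n).
Proof.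
apply: vertex_cover_numberP; last by move=> C; exact: goldberg_cover_ge.
exists (alternating_cover n); last exact: card_alternating_cover.
exact: alternating_cover_vertex_cover.
Qed.
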